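(* There is an algorithm solving ACS+A-Enum in $N^{O(k)}$ time on inputs of size $N$ whose implicational base has conclusion-degree $k$.
   Context: An implicational base $(X,\Sigma)$ is a set of implications $A\to B$ with $A,B\subseteq X$ disjoint; its closed sets are the $C\subseteq X$ with $A\subseteq C\Rightarrow B\subseteq C$ for all $A\to B\in\Sigma$. For $x\in X$, $\mathrm{irr}(x)$ is the family of inclusion-maximal closed sets not containing $x$. The implication graph has an arc $ab$ whenever $a\in A,b\in B$ for some $A\to B\in\Sigma$; $\Sigma$ is acyclic if it is, and $\mathrm{anc}(x)$ is the set of $y\neq x$ with a directed path from $y$ to $x$. The conclusion-degree of $\Sigma$ is the maximum over $x$ of the number of implications whose conclusion contains $x$. ACS+A-Enum: given an acyclic $(X,\Sigma)$, $x\in X$, and $\mathrm{irr}(y)$ for every $y\in\mathrm{anc}(x)$, output $\mathrm{irr}(x)$; the input size is $|X|+|\Sigma|+\sum_{y\in\mathrm{anc}(x)}|\mathrm{irr}(y)|$. *)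

(* Defs.v *)
From mathcomp Require Import all_boot.

Set Implicit Arguments.
Unset Strict Implicit.
Unset Printing Implicit Defensive.

Section ImplicationalBase.
Variable T : finType.

(* The pair (A, B) stands for the implication A -> B. *)
Definition implication := ({set T} * {set T})%type.

Implicit Types (Sigma : {set implication}) (x y : T).

Definition implicational_base Sigma : Prop :=
  forall i, i \in Sigma -> [disjoint i.1 & i.2].

Definition closed_set Sigma (C : {set T}) : bool :=
  [forall i in Sigma, (i.1 \subset C) ==> (i.2 \subset C)].

Definition irr Sigma x : {set {set T}} :=
  [set C | maxset (fun D : {set T} => closed_set Sigma D && (x \notin D)) C].

Definition implication_arc Sigma : rel T :=
  fun a b => [exists i in Sigma, (a \in i.1) && (b \in i.2)].

Definition acyclic Sigma : Prop :=
  forall c : seq T, cycle (implication_arc Sigma) c -> c = [::].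

Definition anc Sigma x : {set T} :=
  [set y | (y != x) && connect (implication_arc Sigma) y x].

Definition conclusion_degree Sigma : nat :=
  \max_(x : T) #|[set i in Sigma | x \in i.2]|.

End ImplicationalBase.

(* Instances of ACS+A-Enum, with the ground set X taken to be {0, ..., n-1}. The
   families irr(y), y \in anc(x), are determined by (X, Sigma) and x; they
   are part of the encoded input (see [encodes_input]). *)
Record instance := Instance {
  ground : nat;
  base : {set implication 'I_ground};
  target : 'I_ground;
  base_valid : implicational_base base;
  base_acyclic : acyclic base
}.

Definition input_size (I : instance) : nat :=
  ground I + #|base I| + \sum_(y in anc (base I) (target I)) #|irr (base I) y|.

(* A bound C * N ^ (c * maxn k 1), with k = degree and N = input_size, is
   N^O(k): if 1 <= k then 2 <= N, so C is absorbed by the exponent. The maxn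
   only matters for k = 0, where a bound N ^ 0 would not allow reading the
   input. *)
Definition degree (I : instance) : nat := conclusion_degree (base I).

(* Model of computation: the WHILE language of N. D. Jones (Computability and
   Complexity from a Programming Perspective, MIT Press, 1997) over binary
   trees, with its unit-cost time measure (one unit per expression node and per
   command executed). Since trees are shared and never mutated, every
   elementary operation is a constant number of pointer operations; the model
   is polynomially equivalent to Turing machines and to RAMs. *)
Inductive tree := Leaf | Node of tree & tree.

Definition left_child (d : tree) : tree := if d is Node l _ then l else Leaf.
Definition right_child (d : tree) : tree := if d is Node _ r then r else Leaf.

Inductive expr :=
  | EVar of nat
  | ENil
  | ECons of expr & expr
  | EHd of expr
  | ETl of expr.

Inductive command :=
  | Assign of nat & expr
  | Seq of command & command
  | If of expr & command & command
  | While of expr & command.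

Definition store := nat -> tree.

Definition set_var (s : store) (v : nat) (d : tree) : store :=
  fun w => if w == v then d else s w.

Fixpoint eval (s : store) (e : expr) : tree :=
  match e with
  | EVar v => s v
  | ENil => Leaf
  | ECons e1 e2 => Node (eval s e1) (eval s e2)
  | EHd e1 => left_child (eval s e1)
  | ETl e1 => right_child (eval s e1)
  end.

Fixpoint expr_time (e : expr) : nat :=
  match e with
  | EVar _ | ENil => 1
  | ECons e1 e2 => (expr_time e1 + expr_time e2).+1
  | EHd e1 | ETl e1 => (expr_time e1).+1
  end.

(* [exec c s t s']: run from store [s], the command [c] halts after exactly [t]
   time units in store [s']. As a condition, Leaf is false, any Node is true. *)
Inductive exec : command -> store -> nat -> store -> Prop :=
  | ExecAssign s v e :
      exec (Assign v e) s (expr_time e).+1 (set_var s v (eval s e))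
  | ExecSeq c1 c2 s s1 s2 t1 t2 :
      exec c1 s t1 s1 -> exec c2 s1 t2 s2 ->
      exec (Seq c1 c2) s (t1 + t2).+1 s2
  | ExecIfTrue e c1 c2 s s1 t :
      eval s e <> Leaf -> exec c1 s t s1 ->
      exec (If e c1 c2) s (expr_time e + t).+1 s1
  | ExecIfFalse e c1 c2 s s1 t :
      eval s e = Leaf -> exec c2 s t s1 ->
      exec (If e c1 c2) s (expr_time e + t).+1 s1
  | ExecWhileTrue e c s s1 s2 t1 t2 :
      eval s e <> Leaf -> exec c s t1 s1 -> exec (While e c) s1 t2 s2 ->
      exec (While e c) s (expr_time e + t1 + t2).+1 s2
  | ExecWhileFalse e c s :
      eval s e = Leaf -> exec (While e c) s (expr_time e).+1 s.

(* Input and output are both in variable 0; other variables start as Leaf. *)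
Definition runs (p : command) (input : tree) (t : nat) (output : tree) : Prop :=
  exists2 s : store,
    exec p (set_var (fun=> Leaf) 0 input) t s & s 0 = output.

Definition tree_of_seq (s : seq tree) : tree := foldr Node Leaf s.

(* Elements of the ground set are encoded in unary. *)
Definition tree_of_nat (m : nat) : tree := tree_of_seq (nseq m Leaf).

Definition tree_of_bool (b : bool) : tree := if b then Node Leaf Leaf else Leaf.

(* The characteristic vector of A. *)
Definition tree_of_set (n : nat) (A : {set 'I_n}) : tree :=
  tree_of_seq [seq tree_of_bool (i \in A) | i <- enum 'I_n].

Definition tree_of_implication (n : nat) (i : implication 'I_n) : tree :=
  Node (tree_of_set i.1) (tree_of_set i.2).

Definition tree_of_family (n : nat) (F : seq {set 'I_n}) : tree :=
  tree_of_seq [seq tree_of_set A | A <- F].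

(* [s] lists the elements of [A], each exactly once, in an arbitrary order. *)
Definition lists (T : finType) (s : seq T) (A : {set T}) : Prop :=
  perm_eq s (enum A).

Definition encodes_input (I : instance) (d : tree) : Prop :=
  exists (imps : seq (implication 'I_(ground I))) (ancs : seq 'I_(ground I))
         (irrs : 'I_(ground I) -> seq {set 'I_(ground I)}),
    [/\ lists imps (base I),
        lists ancs (anc (base I) (target I)),
        forall y, y \in ancs -> lists (irrs y) (irr (base I) y)
      & d = tree_of_seq
              [:: tree_of_nat (ground I);
                  tree_of_nat (target I);
                  tree_of_seq [seq tree_of_implication i | i <- imps];
                  tree_of_seq [seq Node (tree_of_nat y) (tree_of_family (irrs y))
                              | y : 'I_(ground I) <- ancs] ]].

Definition encodes_output (I : instance) (d : tree) : Prop :=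
  exists2 F : seq {set 'I_(ground I)},
    lists F (irr (base I) (target I)) & d = tree_of_family F.

Definition solves_ACSA_Enum_in_time (p : command) (bound : instance -> nat) :
    Prop :=
  forall (I : instance) (input : tree), encodes_input I input ->
    exists (t : nat) (output : tree),
      [/\ runs p input t output, encodes_output I output & t <= bound I].

(* Main.v *)
(** Let [A_i -> B_i] be the implications with [x \in B_i]. A closed set avoiding
[x] misses some [a_i] in every [A_i], hence lies below some [M_i \in irr a_i] for
every [i]. Conversely [(\bigcap_i M_i) :\ x] is closed: an implication leaving it
could only add [x], hence be some [A_i -> B_i], but its premise contains
[a_i \notin M_i]. So [irr x] consists of the maximal sets among these
intersections, and with [k] implications there are at most [N ^ k] of them. *)

Require Import Defs.
From mathcomp Require Import all_boot zify.

Set Implicit Arguments.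
Unset Strict Implicit.
Unset Printing Implicit Defensive.

(** * Maximal members of a family *)

Section Prune.
Variable T : finType.
Implicit Types (D E M : {set T}) (R xs : seq {set T}).

(** The test is one-sided: a set kept earlier is never removed, so a single pass may keep a set
    together with a later, larger one. *)
Definition prune_step R D : seq {set T} :=
  if has (fun E => D \subset E) R then R else D :: R.

Definition prune : seq {set T} -> seq {set T} := foldl prune_step [::].

Lemma prune_rcons xs D : prune (rcons xs D) = prune_step (prune xs) D.
Proof. exact: foldl_rcons. Qed.

Lemma size_prune xs : size (prune xs) <= size xs.
Proof.
elim/last_ind: xs => // xs D IH; rewrite prune_rcons size_rcons /prune_step.
by case: ifP => _ //; apply: leqW.
Qed.

(** Kept sets are pushed in front, so survivors stand in the reverse of the visiting order. This is
    what makes a second pass look at them from the other side. *)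
Lemma subseq_rev_prune xs : subseq (rev (prune xs)) xs.
Proof.
elim/last_ind: xs => // xs D IH; rewrite prune_rcons /prune_step.
case: ifP => _; last by rewrite rev_cons -!cats1 cat_subseq // subseq_refl.
exact: subseq_trans IH (subseq_rcons _ _).
Qed.

Lemma mem_prune xs D : D \in prune xs -> D \in xs.
Proof. by rewrite -mem_rev; apply: (mem_subseq (subseq_rev_prune xs)). Qed.

(** The head is the most recently kept set, and it was tested against everything behind it. *)
Lemma pairwise_prune xs : pairwise (fun D E => ~~ (D \subset E)) (prune xs).
Proof.
elim/last_ind: xs => // xs D IH; rewrite prune_rcons /prune_step.
by case: ifP => //= /negbT; rewrite -all_predC IH andbT.
Qed.

(** A set is dropped only in favour of a kept set above it; for a maximal [M] that set can only be
    [M] itself. *)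
Lemma mem_prune_maximal xs M :
  M \in xs -> {in xs, forall E, M \subset E -> E = M} -> M \in prune xs.
Proof.
elim/last_ind: xs => // xs D IH; rewrite mem_rcons inE prune_rcons /prune_step.
move=> Mxs maxM.
have {}IH : M \in xs -> M \in prune xs.
  by move=> Mx; apply: IH => // E Ex; apply: maxM; rewrite mem_rcons inE Ex orbT.
case: ifPn => [/hasP[E ER DE] | _].
  case/orP: Mxs => // /eqP eD; have : E = M.
    by apply: maxM; rewrite ?eD // mem_rcons inE mem_prune ?orbT.
  by move=> <-.
by rewrite inE; case/orP: Mxs => [->|/IH ->] //; rewrite orbT.
Qed.

(* Each pass keeps no set below one kept before it. The second pass visits the
   survivors of the first in reverse order, so what remains is an antichain. *)
Lemma prune2_antichain xs D E :
  D \in prune (prune xs) -> E \in prune (prune xs) -> D \subset E -> D = E.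
Proof.
set R := prune (prune xs); set r := fun D E : {set T} => ~~ (D \subset E).
have rR : pairwise r R := pairwise_prune (prune xs).
have rR' : pairwise r (rev R).
  exact: subseq_pairwise (subseq_rev_prune _) (pairwise_prune xs).
move=> DR ER DE; apply/eqP; apply: contraT => neDE.
pose i := index D R; pose j := index E R.
have iR : i < size R by rewrite index_mem.
have jR : j < size R by rewrite index_mem.
have [lt_ij|lt_ji|eq_ij] := ltngtP i j.
- by have /(pairwiseP D) /(_ i j iR jR lt_ij) := rR; rewrite /r !nth_index // DE.
- have /(pairwiseP D) /(_ (size R - i.+1) (size R - j.+1)) := rR'.
  rewrite !inE size_rev !nth_rev; try lia.
  rewrite !subnSK // !subKn; try lia.
  rewrite /r !nth_index // DE => h.
  by have : ~~ true by apply: h; lia.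
- by case/eqP: neDE; rewrite -(nth_index D DR) -/i eq_ij nth_index.
Qed.

Lemma prune2_uniq xs : uniq (prune (prune xs)).
Proof.
have := pairwise_prune (prune xs); rewrite uniq_pairwise.
by apply: sub_pairwise => D E; apply: contraNneq => ->.
Qed.

End Prune.

(** * Candidates for irr(x) *)

(** Accumulating loops scramble the order of their output. Up to permutation they are plain
    concatenations, which suffices for membership and size. *)
Lemma perm_foldl_cat (A : Type) (B : eqType) (g : seq B -> A -> seq B)
    (h : A -> seq B) (xs : seq A) acc :
  (forall acc x, perm_eq (g acc x) (h x ++ acc)) ->
  perm_eq (foldl g acc xs) (flatten [seq h x | x <- xs] ++ acc).
Proof.
move=> gh; elim: xs acc => [|x xs IH] acc //=.
apply: perm_trans (IH _) _.
rewrite -catA perm_sym perm_catCA perm_cat2l perm_sym; exact: gh.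
Qed.

Lemma irr_above (T : finType) (Sigma : {set implication T}) (y : T) (C : {set T}) :
  closed_set Sigma C -> y \notin C -> exists2 M, M \in irr Sigma y & C \subset M.
Proof.
move=> clC yC; have [|M maxM CM] := @maxset_exists _
    (fun D : {set T} => closed_set Sigma D && (y \notin D)) C; first by rewrite clC.
by exists M; rewrite ?inE.
Qed.

Section Candidates.
Variable (T : finType) (x : T) (ancs : seq T) (irrs : T -> seq {set T}).
Implicit Types (C D M Z : {set T}) (F : seq {set T}) (i : implication T).

Definition meet_all D F (fam : seq {set T}) : seq {set T} :=
  foldl (fun acc M => (D :&: M) :: acc) F fam.

(** Scanning [ancs] finds the whole premise when [x] is in [i.2]: each premise element then has an
    arc to [x] and, by disjointness, differs from [x]. *)
Definition meet_ancs i D F : seq {set T} :=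
  foldl (fun acc y => if y \in i.1 then meet_all D acc (irrs y) else acc) F ancs.

Definition extend F i : seq {set T} :=
  if x \in i.2 then foldl (fun acc D => meet_ancs i D acc) [::] F else F.

(** The start [[set~ x]] is the empty intersection with [x] removed. Each implication concluding [x]
    then branches over all choices of a premise element and a member of its irr family. *)
Definition candidates (imps : seq (implication T)) : seq {set T} :=
  foldl extend [:: [set~ x]] imps.

Lemma perm_meet_all D F fam :
  perm_eq (meet_all D F fam) ([seq D :&: M | M <- fam] ++ F).
Proof.
elim: fam F => [|M fam IH] F //=; apply: perm_trans (IH _) _.
by rewrite -cat1s perm_catCA.
Qed.

Lemma perm_meet_ancs i D F :
  perm_eq (meet_ancs i D F)
    (flatten [seq if y \in i.1 then [seq D :&: M | M <- irrs y] else [::]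
             | y <- ancs] ++ F).
Proof.
by apply: perm_foldl_cat => acc y; case: ifP => // _; apply: perm_meet_all.
Qed.

Lemma perm_extend F i : x \in i.2 ->
  perm_eq (extend F i)
    (flatten [seq flatten [seq if y \in i.1 then [seq D :&: M | M <- irrs y]
                               else [::] | y <- ancs] | D <- F]).
Proof.
move=> xi; rewrite /extend xi -[X in perm_eq _ X]cats0.
by apply: perm_foldl_cat => acc D; apply: perm_meet_ancs.
Qed.

Lemma mem_extend F i Z : x \in i.2 ->
  reflect (exists D y M, [/\ D \in F, y \in ancs, y \in i.1, M \in irrs y &
                             Z = D :&: M])
          (Z \in extend F i).
Proof.
move=> xi; rewrite (perm_mem (perm_extend F xi)); apply: (iffP flattenP).
  move=> [_ /mapP[D DF ->] /flattenP[_ /mapP[y ya ->]]].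
  by case: ifP => // yi /mapP[M My ->]; exists D, y, M.
move=> [D [y [M [DF ya yi My ->]]]].
eexists; first by apply/mapP; exists D.
apply/flattenP; eexists; first by apply/mapP; exists y.
by rewrite yi; apply/mapP; exists M.
Qed.

Lemma size_extend F i :
  x \in i.2 -> size (extend F i) <= size F * \sum_(y <- ancs) size (irrs y).
Proof.
move=> xi; rewrite (perm_size (perm_extend F xi)) size_flatten sumnE.
rewrite /shape !big_map -sum1_size big_distrl /=.
apply: leq_sum => D _; rewrite mul1n size_flatten sumnE !big_map.
by apply: leq_sum => y _; case: ifP => // _; rewrite size_map.
Qed.

(** Only implications concluding [x] change the list, each multiplying its length by at most [N].
    Treating every prefix [p] bounds all intermediate lists of the main loop at once. *)
Lemma size_candidates imps p r N : imps = p ++ r -> 0 < N ->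
  \sum_(y <- ancs) size (irrs y) <= N ->
  size (candidates p) <= N ^ count (fun i => x \in i.2) imps.
Proof.
move=> -> N0 le_N; rewrite count_cat.
apply: leq_trans (leq_pexp2l N0 (leq_addr _ _)).
elim/last_ind: p => [|p i IH]; first by rewrite expn0.
rewrite /candidates foldl_rcons -/(candidates p) -cats1 count_cat /= addn0.
case xi: (x \in i.2); last by rewrite addn0 /extend xi.
rewrite addn1 expnSr; apply: leq_trans (size_extend _ xi) _.
exact: leq_mul.
Qed.

Variable Sigma : {set implication T}.
Hypothesis base_Sigma : implicational_base Sigma.
Hypothesis ancsE : ancs =i anc Sigma x.
Hypothesis irrsE : {in ancs, forall y, irrs y =i irr Sigma y}.

(* The second clause says that Z is closed up to x, the third that each
   implication treated so far and concluding x is blocked by its premise. *)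
Lemma candidates_closed imps Z : Z \in candidates imps ->
  [/\ x \notin Z,
      {in Sigma, forall i, i.1 \subset Z -> i.2 \subset x |: Z} &
      {in imps, forall i, x \in i.2 -> ~~ (i.1 \subset Z)}].
Proof.
elim/last_ind: imps Z => [|p i IH] Z.
  rewrite /candidates /= inE => /eqP->; split=> //.
    by rewrite !inE eqxx.
  by move=> i _ _; rewrite setUCr subsetT.
rewrite /candidates foldl_rcons -/(candidates p).
case xi: (x \in i.2); last first.
  rewrite /extend xi => /IH[xZ cZ bZ]; split=> // j.
  by rewrite mem_rcons inE => /predU1P[->|/bZ//]; rewrite xi.
case/(mem_extend _ _ xi) => D [y [M [/IH[xD cD bD] ya yi My ->]]].
move: My; rewrite irrsE // inE => /maxsetP[/andP[cM yM] _].
split.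
- by rewrite inE (negPf xD).
- move=> j jS; rewrite subsetI => /andP[jD jM].
  rewrite setUIr subsetI cD //=.
  move/forall_inP: cM => /(_ j jS) /implyP/(_ jM) h.
  exact: subset_trans h (subsetUr _ _).
- move=> j; rewrite mem_rcons inE => /predU1P[->|jp] xj.
    by apply/subsetPn; exists y => //; rewrite inE (negPf yM) andbF.
  by rewrite subsetI negb_and bD.
Qed.

(** Among the branches of each [extend], one can be chosen that keeps the intersection above [C]. *)
Lemma candidates_cover imps C : {subset imps <= Sigma} ->
  closed_set Sigma C -> x \notin C ->
  exists2 Z, Z \in candidates imps & C \subset Z.
Proof.
move=> sub clC xC; have cC i : i \in Sigma -> i.1 \subset C -> i.2 \subset C.
  by move=> iS; move/forall_inP: clC => /(_ i iS) /implyP.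
elim/last_ind: imps sub => [|p i IH] sub.
  by exists [set~ x]; rewrite ?inE // subsetC sub1set inE.
have [|Z Zp CZ] := IH.
  by move=> j jp; apply: sub; rewrite mem_rcons inE jp orbT.
have iS : i \in Sigma by apply: sub; rewrite mem_rcons inE eqxx.
rewrite /candidates foldl_rcons -/(candidates p).
case xi: (x \in i.2); last by exists Z => //; rewrite /extend xi.
(* Otherwise closedness of [C] would put [x] into [C]. *)
have /subsetPn[y yi yC] : ~~ (i.1 \subset C).
  by apply/negP => /(cC i iS) /subsetP/(_ x xi); apply/negP.
have ya : y \in ancs.
  rewrite ancsE inE; apply/andP; split.
    apply: contraTneq xi => <-.
    by have /disjointFr/(_ yi)-> := base_Sigma iS.
  by apply: connect1; apply/exists_inP; exists i; rewrite ?yi.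
have [M My CM] := irr_above clC yC.
exists (Z :&: M); last by rewrite subsetI CZ.
apply/mem_extend => //; exists Z, y, M; split=> //.
by rewrite irrsE.
Qed.

(** Every candidate is closed and avoids [x], and every member of [irr Sigma x] is a maximal
    candidate, hence survives both passes. *)
Lemma lists_prune_candidates imps : imps =i Sigma ->
  lists (prune (prune (candidates imps))) (irr Sigma x).
Proof.
move=> impsE; set R := prune _.
(* An implication with premise inside [Z] could add only [x], but those concluding [x] are
   blocked. *)
have good Z : Z \in candidates imps -> closed_set Sigma Z && (x \notin Z).
  move=> /candidates_closed[xZ cZ bZ]; rewrite xZ andbT.
  apply/forall_inP => i iS; apply/implyP => iZ; apply/subsetP => z zi.
  have /subsetP/(_ z zi) := cZ i iS iZ; rewrite !inE => /predU1P[zx|//].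
  by move: (bZ i); rewrite impsE iZ -zx => /(_ iS zi).
have irrR M : M \in irr Sigma x -> M \in R.
  rewrite inE => /maxsetP[/andP[cM xM] maxM].
  have cand E : E \in candidates imps -> M \subset E -> E = M.
    by move=> /good gE; apply: maxM.
  have [|Z Zc MZ] := @candidates_cover imps M _ cM xM.
    by move=> i; rewrite impsE.
  have Mc : M \in candidates imps by rewrite -(cand Z Zc MZ).
  apply: mem_prune_maximal; first exact: mem_prune_maximal.
  by move=> E /mem_prune; apply: cand.
apply: uniq_perm; rewrite ?enum_uniq ?prune2_uniq // => D; rewrite mem_enum.
apply/idP/idP => [DR|/irrR//].
have /good/andP[cD xD] := mem_prune (mem_prune DR).
(* A survivor [D] lies below a member of [irr Sigma x], itself a survivor; the antichain property
   identifies the two. *)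
have [M MR DM] := irr_above cD xD.
by rewrite (prune2_antichain DR (irrR _ MR) DM).
Qed.

End Candidates.

(** * Timed execution of WHILE programs *)

Fixpoint writes (c : command) : seq nat :=
  match c with
  | Assign v _ => [:: v]
  | Seq c1 c2 | If _ c1 c2 => writes c1 ++ writes c2
  | While _ c => writes c
  end.

Definition agree_off (ws : seq nat) (s s' : store) : Prop :=
  forall w, w \notin ws -> s w = s' w.

Lemma exec_frame c s t s' : exec c s t s' -> agree_off (writes c) s' s.
Proof.
elim=> {c s t s'} [s v e|c1 c2 s s1 s2 t1 t2 _ IH1 _ IH2
  |e c1 c2 s s1 t _ _ IH|e c1 c2 s s1 t _ _ IH
  |e c s s1 s2 t1 t2 _ _ IH1 _ IH2|e c s _] w /=.
- by rewrite inE /set_var => /negPf->.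
- by rewrite mem_cat negb_or => /andP[w1 w2]; rewrite IH2 // IH1.
- by rewrite mem_cat negb_or => /andP[w1 w2]; rewrite IH.
- by rewrite mem_cat negb_or => /andP[w1 w2]; rewrite IH.
- by move=> ww; rewrite IH2 // IH1.
- by [].
Qed.

(** Total correctness with a time budget: [T] is an upper bound, unlike the exact time in [exec]. *)
Definition halts (c : command) (s : store) (T : nat) (Q : store -> Prop) : Prop :=
  exists t s', [/\ exec c s t s', t <= T & Q s'].

Lemma halts_conseq c s T T' (Q Q' : store -> Prop) :
  halts c s T Q -> T <= T' -> (forall s', Q s' -> Q' s') -> halts c s T' Q'.
Proof.
move=> [t [s' [ex tT q]]] le QQ'; exists t, s'; split=> //; last exact: QQ'.
exact: leq_trans le.
Qed.

Lemma halts_weaken c s T T' Q : halts c s T Q -> T <= T' -> halts c s T' Q.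
Proof. by move=> h le; apply: halts_conseq h le _. Qed.

Lemma halts_assign v e s T (Q : store -> Prop) :
  Q (set_var s v (eval s e)) -> expr_time e < T -> halts (Assign v e) s T Q.
Proof.
move=> q le; exists (expr_time e).+1, (set_var s v (eval s e)).
by split=> //; apply: ExecAssign.
Qed.

(** The continuation also receives the frame of [c1], so that [Q1] need not mention unchanged
    variables. *)
Lemma halts_seq c1 c2 s T1 T2 (Q1 Q : store -> Prop) :
  halts c1 s T1 Q1 ->
  (forall s1, agree_off (writes c1) s1 s -> Q1 s1 -> halts c2 s1 T2 Q) ->
  halts (Seq c1 c2) s (T1 + T2).+1 Q.
Proof.
move=> [t1 [s1 [ex1 le1 q1]]] /(_ s1 (exec_frame ex1) q1) [t2 [s2 [ex2 le2 q2]]].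
by do 2 eexists; split; [apply: ExecSeq ex1 ex2|rewrite ltnS leq_add|].
Qed.

Lemma halts_assign_seq v e c s T (Q : store -> Prop) :
  halts c (set_var s v (eval s e)) T Q ->
  halts (Seq (Assign v e) c) s (expr_time e + T).+2 Q.
Proof.
move=> [t [s' [ex le q]]].
do 2 eexists; split; [exact: ExecSeq (ExecAssign _ _ _) ex| |exact: q].
by rewrite addSn !ltnS leq_add2l.
Qed.

Lemma halts_if (b : bool) e c1 c2 s T (Q : store -> Prop) :
  eval s e = tree_of_bool b ->
  (if b then halts c1 s T Q else halts c2 s T Q) ->
  halts (If e c1 c2) s (expr_time e + T).+1 Q.
Proof.
move=> ev; case: b ev => ev [t [s' [ex le q]]]; exists (expr_time e + t).+1, s'.
  by split; rewrite ?ltnS ?leq_add2l //; apply: ExecIfTrue ex; rewrite ev.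
by split; rewrite ?ltnS ?leq_add2l //; apply: ExecIfFalse ex; rewrite ev.
Qed.

(* [l] holds the part of the list still to be visited, [v] the current item. *)
Definition foreach (l v : nat) (e : expr) (body : command) : command :=
  Seq (Assign l e)
      (While (EVar l)
         (Seq (Assign v (EHd (EVar l))) (Seq (Assign l (ETl (EVar l))) body))).

(** Invariant rule: after a prefix [p], variable [a] encodes the left fold of [g] over [p]. The
    splitting of [xs] lets the body use membership of [x] and size bounds on prefixes. The 10 units
    per item pay for the test, the two assignments and the control nodes. *)
Lemma halts_foreach (A B : Type) (f : A -> tree) (g : B -> A -> B)
    (enc : B -> tree) (a l v : nat) e body s xs b0 T :
  eval s e = tree_of_seq [seq f x | x <- xs] -> s a = enc b0 ->
  uniq [:: a; l; v] -> l \notin writes body ->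
  (forall p x r s', xs = p ++ x :: r ->
     agree_off [:: l, v & writes body] s' s ->
     s' a = enc (foldl g b0 p) -> s' v = f x ->
     halts body s' T (fun s'' => s'' a = enc (g (foldl g b0 p) x))) ->
  halts (foreach l v e body) s (size xs * (T + 10) + expr_time e + 4)
    (fun s' => s' a = enc (foldl g b0 xs)).
Proof.
move=> ev sa /=; rewrite !inE negb_or !andbT => /andP[/andP[al av] lv] lb step.
have loop : forall r p s', xs = p ++ r -> s' l = tree_of_seq [seq f x | x <- r] ->
    agree_off [:: l, v & writes body] s' s -> s' a = enc (foldl g b0 p) ->
  halts (While (EVar l)
         (Seq (Assign v (EHd (EVar l))) (Seq (Assign l (ETl (EVar l))) body))) s'
    (size r * (T + 10) + 2) (fun s' => s' a = enc (foldl g b0 xs)).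
  elim=> [|x r IH] p s' exs sl ag s'a.
    exists 2, s'; split=> //; last by rewrite s'a exs cats0.
    exact: (@ExecWhileFalse (EVar l)).
  set s1 := set_var s' v (f x).
  set s2 := set_var s1 l (tree_of_seq [seq f x | x <- r]).
  have s2l : s2 l = tree_of_seq [seq f x | x <- r] by rewrite /s2 /set_var eqxx.
  have ag2 : agree_off [:: l, v & writes body] s2 s.
    move=> w; rewrite !inE !negb_or /s2 /s1 /set_var => /and3P[wl wv wb].
    by rewrite (negPf wl) (negPf wv) ag // !inE !negb_or wl wv.
  have s2a : s2 a = enc (foldl g b0 p).
    by rewrite /s2 /s1 /set_var (negPf al) (negPf av).
  have s2v : s2 v = f x.
    by rewrite /s2 /s1 /set_var eq_sym (negPf lv) eqxx.
  have [t [s3 [ex3 le3 q3]]] := step p x r s2 exs ag2 s2a s2v.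
  have fr := exec_frame ex3.
  have [||||t' [s4 [ex4 le4 q4]]] := IH (rcons p x) s3.
  - by rewrite cat_rcons.
  - by rewrite fr.
  - move=> w ww; rewrite fr ?ag2 //.
    by move: ww; rewrite !inE !negb_or => /and3P[].
  - by rewrite q3 foldl_rcons.
  exists (1 + (3 + (3 + t).+1).+1 + t').+1, s4; split=> //.
    apply: ExecWhileTrue ex4; first by rewrite /= sl.
    apply: (@ExecSeq _ _ _ s1 _ 3).
      suff -> : s1 = set_var s' v (eval s' (EHd (EVar l))) by apply: ExecAssign.
      by rewrite /= sl.
    apply: (@ExecSeq _ _ _ s2 _ 3) ex3.
    suff -> : s2 = set_var s1 l (eval s1 (ETl (EVar l))) by apply: ExecAssign.
    by rewrite /= {2}/s1 /set_var (negPf lv) sl.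
  rewrite /= mulSn; lia.
have ag0 : agree_off [:: l, v & writes body] (set_var s l (eval s e)) s.
  by move=> w; rewrite inE negb_or /set_var => /andP[/negPf->].
have := loop xs [::] (set_var s l (eval s e)) erefl _ ag0.
rewrite /set_var eqxx (negPf al) => /(_ ev sa) h.
apply: halts_conseq (halts_assign_seq h) _ _ => //; lia.
Qed.

(** * The program *)

Declare Scope command_scope.
Local Infix ";;" := Seq (at level 60, right associativity) : command_scope.
Local Open Scope command_scope.

(** Variable 0 keeps the input until the last assignment. The variables 4, 6, 10, 12, 14 and 17 hold
    the lists being traversed, and nested loops use different ones. *)
Local Notation e_ground := (EHd (EVar 0)).
Local Notation e_target := (EHd (ETl (EVar 0))).
Local Notation e_imps := (EHd (ETl (ETl (EVar 0)))).
Local Notation e_ancs := (EHd (ETl (ETl (ETl (EVar 0))))).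
Local Notation e_true := (ECons ENil ENil).

Local Notation v_count := 1.
Local Notation v_init := 2.
Local Notation v_cands := 3.
Local Notation v_imp := 5.
Local Notation v_drop := 8.
Local Notation v_new := 9.
Local Notation v_cand := 11.
Local Notation v_anc := 13.
Local Notation v_other := 15.
Local Notation v_zip := 16.
Local Notation v_bit := 18.
Local Notation v_meet := 19.
Local Notation v_kept := 22.
Local Notation v_keep := 23.

(* The head of [v_drop] ends up as the membership bit. *)
Definition p_member (e_elt e_set : expr) : command :=
  Assign v_drop e_set ;;
  foreach 6 7 e_elt (Assign v_drop (ETl (EVar v_drop))).

(** The vector is pushed from its end: [v_count] is cut down to length n - x, its tail gives n - x -
    1 ones, then come the zero at x and x more ones. *)
Definition p_init : command :=
  Assign v_count e_ground ;;
  foreach 6 7 e_target (Assign v_count (ETl (EVar v_count))) ;;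
  Assign v_init ENil ;;
  foreach 6 7 (ETl (EVar v_count)) (Assign v_init (ECons e_true (EVar v_init))) ;;
  Assign v_init (ECons ENil (EVar v_init)) ;;
  foreach 6 7 e_target (Assign v_init (ECons e_true (EVar v_init))) ;;
  Assign v_cands (ECons (EVar v_init) ENil).

(* The left child of [v_zip] is the unread part of the second set; the right
   child accumulates the intersection, in reverse order. *)
Definition p_meet : command :=
  Assign v_zip (ECons (EVar v_other) ENil) ;;
  foreach 17 v_bit (EVar v_cand)
    (If (EVar v_bit)
       (Assign v_zip (ECons (ETl (EHd (EVar v_zip)))
                            (ECons (EHd (EHd (EVar v_zip))) (ETl (EVar v_zip)))))
       (Assign v_zip (ECons (ETl (EHd (EVar v_zip)))
                            (ECons ENil (ETl (EVar v_zip)))))) ;;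
  Assign v_meet ENil ;;
  foreach 17 v_bit (ETl (EVar v_zip))
    (Assign v_meet (ECons (EVar v_bit) (EVar v_meet))).

(* The right child of [v_zip] ends up as the inclusion bit. *)
Definition p_subset : command :=
  Assign v_zip (ECons (EVar v_other) e_true) ;;
  foreach 17 v_bit (EVar v_cand)
    (If (EVar v_bit)
       (If (EHd (EHd (EVar v_zip)))
          (Assign v_zip (ECons (ETl (EHd (EVar v_zip))) (ETl (EVar v_zip))))
          (Assign v_zip (ECons (ETl (EHd (EVar v_zip))) ENil)))
       (Assign v_zip (ECons (ETl (EHd (EVar v_zip))) (ETl (EVar v_zip))))).

Definition p_meet_all : command :=
  foreach 14 v_other (ETl (EVar v_anc))
    (p_meet ;; Assign v_new (ECons (EVar v_meet) (EVar v_new))).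

(** A self-assignment serves as the empty command in an else branch, here and below. *)
Definition p_meet_ancs : command :=
  foreach 12 v_anc e_ancs
    (p_member (EHd (EVar v_anc)) (EHd (EVar v_imp)) ;;
     If (EHd (EVar v_drop)) p_meet_all (Assign v_new (EVar v_new))).

Definition p_extend : command :=
  p_member e_target (ETl (EVar v_imp)) ;;
  If (EHd (EVar v_drop))
    (Assign v_new ENil ;;
     foreach 10 v_cand (EVar v_cands) p_meet_ancs ;;
     Assign v_cands (EVar v_new))
    (Assign v_cands (EVar v_cands)).

Definition p_prune : command :=
  Assign v_kept ENil ;;
  foreach 10 v_cand (EVar v_cands)
    (Assign v_keep e_true ;;
     foreach 14 v_other (EVar v_kept)
       (p_subset ;;
        If (ETl (EVar v_zip)) (Assign v_keep ENil) (Assign v_keep (EVar v_keep))) ;;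
     If (EVar v_keep) (Assign v_kept (ECons (EVar v_cand) (EVar v_kept)))
       (Assign v_kept (EVar v_kept))) ;;
  Assign v_cands (EVar v_kept).

Definition p_main : command :=
  p_init ;; foreach 4 v_imp e_imps p_extend ;; p_prune ;; p_prune ;;
  Assign 0 (EVar v_cands).

(** * Correctness and running time of the subroutines *)

Lemma right_child_tree_of_seq ts :
  right_child (tree_of_seq ts) = tree_of_seq (behead ts).
Proof. by case: ts. Qed.

Lemma foldl_right_child (A : Type) (r : seq A) ts :
  foldl (fun d _ => right_child d) (tree_of_seq ts) r =
  tree_of_seq (drop (size r) ts).
Proof.
elim: r ts => [|a r IH] ts /=; first by rewrite drop0.
by rewrite right_child_tree_of_seq IH -drop1 drop_drop addn1.
Qed.

Lemma foldl_cons_const (A : Type) (r : seq A) t ts :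
  foldl (fun d _ => Node t d) (tree_of_seq ts) r =
  tree_of_seq (nseq (size r) t ++ ts).
Proof.
elim: r ts => [|a r IH] ts //=; rewrite (IH (t :: ts)).
by elim: (size r) => //= m ->.
Qed.

Section Sets.
Variable n : nat.
Implicit Types (A D E M : {set 'I_n}) (y : 'I_n).

Lemma tree_of_natE m : tree_of_nat m = tree_of_seq [seq t | t <- nseq m Leaf].
Proof. by rewrite map_id. Qed.

Lemma member_tree y A :
  left_child (tree_of_seq (drop y [seq tree_of_bool (i \in A) | i <- enum 'I_n])) =
  tree_of_bool (y \in A).
Proof.
rewrite -map_drop (drop_nth y) ?size_enum_ord // /=.
by rewrite (_ : nth y _ _ = y) //; apply: val_inj; rewrite /= nth_enum_ord.
Qed.

(** [e_elt] is evaluated after [v_drop] has been overwritten, hence the quantification over [d].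
    There are y < n rounds of 3 + 10 units. *)
Lemma halts_member e_elt e_set s y A :
  eval s e_set = tree_of_set A ->
  (forall d, eval (set_var s v_drop d) e_elt = tree_of_nat y) ->
  halts (p_member e_elt e_set) s (13 * n + expr_time e_set + expr_time e_elt + 6)
    (fun s' => left_child (s' v_drop) = tree_of_bool (y \in A)).
Proof.
move=> eA eY.
apply: halts_conseq.
- apply: halts_assign_seq.
  apply: (@halts_foreach tree tree id (fun d _ => right_child d) id v_drop _ _
    _ _ _ (nseq y Leaf) (tree_of_set A) 3) => //.
  + by rewrite eY tree_of_natE.
  + move=> p t r s' _ _ sa _; by apply: halts_assign; rewrite /set_var /= ?sa.
- rewrite size_nseq; have := ltn_ord y; lia.
- by move=> s' -> /=; rewrite /tree_of_set foldl_right_child size_nseq member_tree.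
Qed.

Lemma tree_of_setC1 y :
  tree_of_set [set~ y] =
  tree_of_seq (nseq y (Node Leaf Leaf) ++ Leaf :: nseq (n - y.+1) (Node Leaf Leaf)).
Proof.
rewrite /tree_of_set; congr tree_of_seq.
have yn := ltn_ord y.
apply: (@eq_from_nth _ Leaf) => [|i].
  by rewrite size_map size_enum_ord size_cat /= !size_nseq; lia.
rewrite size_map size_enum_ord => lt_i.
rewrite (nth_map y) ?size_enum_ord // !inE nth_cat size_nseq nth_nseq.
have -> : (nth y (enum 'I_n) i == y) = (i == y).
  by rewrite -val_eqE /= nth_enum_ord.
have [lt|gt|eq] := ltngtP i y => //=; last by rewrite eq subnn.
have : 0 < i - y by lia.
by case di: (i - y) => [|j] //= _; rewrite nth_nseq ifT //; lia.
Qed.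

(** Effect of one round of the first loop of [p_meet] on [v_zip], stated on raw trees so that the
    loop rule applies with the identity encoding. *)
Definition zip_meet D (d : tree) (i : 'I_n) : tree :=
  Node (right_child (left_child d))
    (Node (if i \in D then left_child (left_child d) else Leaf) (right_child d)).

Lemma foldl_zip_meet D M (r : seq 'I_n) ts :
  foldl (zip_meet D)
    (Node (tree_of_seq [seq tree_of_bool (i \in M) | i <- r]) (tree_of_seq ts)) r =
  Node Leaf (tree_of_seq (catrev [seq tree_of_bool (i \in D :&: M) | i <- r] ts)).
Proof.
elim: r ts => //= i r IH ts; rewrite -IH inE {2}/zip_meet /=.
by case: (i \in D).
Qed.

Lemma halts_meet s D M :
  s v_cand = tree_of_set D -> s v_other = tree_of_set M ->
  halts p_meet s (60 * n + 40) (fun s' => s' v_meet = tree_of_set (D :&: M)).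
Proof.
move=> sD sM; apply: halts_conseq.
- apply: halts_assign_seq; apply: halts_seq.
    apply: (@halts_foreach 'I_n tree (fun i => tree_of_bool (i \in D))
      (zip_meet D) id v_zip _ _ _ _ _ (enum 'I_n)
      (Node (tree_of_set M) Leaf) 20) => //.
      by rewrite /set_var /= sM.
    move=> p i r s' _ _ sa sv; apply: halts_weaken.
    + apply: (halts_if (b := i \in D) (T := 15)); first exact: sv.
      move: sa; set d := foldl _ _ _ => sa; rewrite /zip_meet.
      by case: (i \in D); apply: halts_assign; rewrite /set_var /= ?sa.
    + by [].
  (* The initial [Leaf] is read as an empty accumulator. The bits come out reversed, and the second
     loop restores their order. *)
  move=> s1 _ /=; rewrite -[Leaf]/(tree_of_seq [::]) foldl_zip_meet => s1z.
  apply: halts_assign_seq.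
  apply: (@halts_foreach tree tree id (fun d t => Node t d) id v_meet _ _ _ _ _
    (rev [seq tree_of_bool (i \in D :&: M) | i <- enum 'I_n]) Leaf 4) => //.
    by rewrite /= /set_var /= s1z map_id.
  move=> p t r s' _ _ sa sv.
  by apply: halts_assign; rewrite /set_var /= ?sa ?sv.
- by rewrite /= size_rev size_map !size_enum_ord; lia.
- by move=> s' ->; rewrite foldl_rev.
Qed.

(** The right child is a flag, cleared for good at the first index in [D] whose bit in the other set
    is [Leaf]. *)
Definition zip_subset D (d : tree) (i : 'I_n) : tree :=
  Node (right_child (left_child d))
    (if i \in D then
       if left_child (left_child d) is Leaf then Leaf else right_child d
     else right_child d).

Lemma foldl_zip_subset D E (r : seq 'I_n) b :
  foldl (zip_subset D)
    (Node (tree_of_seq [seq tree_of_bool (i \in E) | i <- r]) (tree_of_bool b)) r =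
  Node Leaf (tree_of_bool (b && all (fun i => (i \in D) ==> (i \in E)) r)).
Proof.
elim: r b => [|i r IH] b /=; first by rewrite andbT.
rewrite {2}/zip_subset /=.
have -> : (if i \in D then
             if tree_of_bool (i \in E) is Leaf then Leaf else tree_of_bool b
           else tree_of_bool b) = tree_of_bool (b && ((i \in D) ==> (i \in E))).
  by case: (i \in D) (i \in E) b => [] [] [].
by rewrite IH andbA.
Qed.

Lemma halts_subset s D E :
  s v_cand = tree_of_set D -> s v_other = tree_of_set E ->
  halts p_subset s (40 * n + 40)
    (fun s' => right_child (s' v_zip) = tree_of_bool (D \subset E)).
Proof.
move=> sD sE; apply: halts_conseq.
- apply: halts_assign_seq.
  apply: (@halts_foreach 'I_n tree (fun i => tree_of_bool (i \in D))
    (zip_subset D) id v_zip _ _ _ _ _ (enum 'I_n)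
    (Node (tree_of_set E) (tree_of_bool true)) 30) => //.
    by rewrite /set_var /= sE.
  move=> p i r s' _ _ sa sv; apply: halts_weaken.
  + apply: (halts_if (b := i \in D) (T := 20)); first exact: sv.
    move: sa; set d := foldl _ _ _ => sa; rewrite /zip_subset.
    case: (i \in D); last by apply: halts_assign; rewrite /set_var /= ?sa.
    case dE: (left_child (left_child d)) => [|d1 d2].
      apply: halts_weaken.
      * apply: (halts_if (b := false) (T := 10)); first by rewrite /= sa.
        by apply: halts_assign; rewrite /set_var /= ?sa.
      * by [].
    (* The tested tree is only known to be a [Node], not an encoded boolean, so the run is given
       explicitly: 3 units for the test, 7 for the assignment, 1 for the branching. *)
    pose e := ECons (ETl (EHd (EVar v_zip))) (ETl (EVar v_zip)).
    exists 11, (set_var s' v_zip (eval s' e)).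
    split=> //; last by rewrite /set_var /= sa.
    by apply: (@ExecIfTrue _ _ _ _ _ 7); [rewrite /= sa dE|apply: ExecAssign].
  + by [].
- by rewrite /= size_enum_ord; lia.
- move=> s' ->; rewrite /= (foldl_zip_subset D E _ true) /=.
  congr tree_of_bool; apply/allP/subsetP => h i.
    by move=> iD; have := h i; rewrite mem_enum iD => /(_ isT).
  by move=> _; apply/implyP/h.
Qed.

Lemma halts_init s (x : 'I_n) d :
  s 0 = Node (tree_of_nat n) (Node (tree_of_nat x) d) ->
  halts p_init s (100 * n + 100)
    (fun s' => s' v_cands = tree_of_family [:: [set~ x]]).
Proof.
move=> s0; have xn := ltn_ord x; apply: halts_weaken.
- apply: halts_assign_seq; apply: halts_seq.
    apply: (@halts_foreach tree tree id (fun d _ => right_child d) id v_count _ _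
      _ _ _ (nseq x Leaf) (tree_of_nat n) 3) => //.
    + by rewrite /= /set_var /= s0 (tree_of_natE x).
    + by rewrite /set_var /= s0.
    + move=> p t r s' _ _ sa _; by apply: halts_assign; rewrite /set_var /= ?sa.
  move=> s1 ag1; rewrite foldl_right_child size_nseq drop_nseq => s1c.
  have s10 : s1 0 = s 0 by rewrite ag1.
  apply: halts_assign_seq; apply: halts_seq.
    apply: (@halts_foreach tree tree id (fun d _ => Node (Node Leaf Leaf) d) id
      v_init _ _ _ _ _ (nseq (n - x.+1) Leaf) Leaf 6) => //.
    + rewrite /= /set_var /= s1c right_child_tree_of_seq map_id.
      by rewrite -drop1 drop_nseq subn1 subnS.
    + move=> p t r s' _ _ sa _; by apply: halts_assign; rewrite /set_var /= ?sa.
  move=> s2 ag2; rewrite (foldl_cons_const _ _ [::]) size_nseq cats0 => s2i.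
  have s20 : s2 0 = s 0 by rewrite ag2.
  apply: halts_assign_seq; apply: halts_seq.
    apply: (@halts_foreach tree tree id (fun d _ => Node (Node Leaf Leaf) d) id
      v_init _ _ _ _ _ (nseq x Leaf)
      (tree_of_seq (Leaf :: nseq (n - x.+1) (Node Leaf Leaf))) 6) => //.
    + by rewrite /= /set_var /= s20 s0 (tree_of_natE x).
    + by rewrite /= /set_var /= s2i.
    + move=> p t r s' _ _ sa _; by apply: halts_assign; rewrite /set_var /= ?sa.
  move=> s3 ag3; rewrite foldl_cons_const size_nseq -tree_of_setC1 => s3i.
  by apply: (@halts_assign _ _ _ 5); rewrite /set_var /= ?s3i.
- by rewrite /= !size_nseq; lia.
Qed.

Lemma foldl_subset_flag D (F : seq {set 'I_n}) :
  foldl (fun b E => if D \subset E then false else b) true F =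
  ~~ has (fun E => D \subset E) F.
Proof.
(* The induction needs an arbitrary initial flag, introduced here as a conjunct. *)
rewrite -[RHS]andTb; elim: F true => [|E F IH] b /=; first by rewrite andbT.
by rewrite IH; case: ifP => _; rewrite ?andbF.
Qed.

Lemma halts_prune s (F : seq {set 'I_n}) :
  s v_cands = tree_of_family F ->
  halts p_prune s (200 * (size F).+1 * (size F).+1 * n.+1)
    (fun s' => s' v_cands = tree_of_family (prune F)).
Proof.
move=> sF; apply: halts_weaken.
- apply: halts_assign_seq; apply: halts_seq.
    apply: (@halts_foreach _ _ (@tree_of_set n) (@prune_step _) (@tree_of_family n)
      v_kept _ _ _ _ _ F [::] (150 * (size F).+1 * n.+1)) => //.
    move=> p D r s' eF _ sk sc; rewrite -/(prune p) in sk *.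
    apply: halts_weaken.
    + apply: halts_assign_seq; apply: halts_seq.
        apply: (@halts_foreach _ _ (@tree_of_set n)
          (fun b E => if D \subset E then false else b) tree_of_bool
          v_keep _ _ _ _ _ (prune p) true (40 * n + 60)) => //.
        move=> q E r' s1 _ ag1 s1k s1o; apply: halts_weaken.
        * apply: halts_seq.
            apply: (@halts_subset _ D E) => //.
            by rewrite ag1 // /set_var /= sc.
          move=> s2 ag2 s2z.
          apply: (halts_if (b := D \subset E) (T := 3)); first exact: s2z.
          have s2k : s2 v_keep = s1 v_keep by rewrite ag2.
          by case: (D \subset E); apply: halts_assign; rewrite /set_var /= ?s2k ?s1k.
        * by rewrite /=; lia.
      move=> s1 ag1; rewrite foldl_subset_flag => s1k.
      have s1kept : s1 v_kept = tree_of_family (prune p) by rewrite ag1.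
      have s1c : s1 v_cand = tree_of_set D by rewrite ag1.
      apply: (halts_if (b := ~~ has (fun E => D \subset E) (prune p)) (T := 8)).
        by rewrite /= s1k.
      rewrite /prune_step.
      by case: (has _ _); apply: halts_assign; rewrite /set_var /= ?s1kept ?s1c.
    (* The inner loop runs over the sets kept so far, never more than [size F]; this makes pruning
       quadratic. *)
    + have : size (prune p) <= size F.
        by apply: leq_trans (size_prune p) _; rewrite eF size_cat leq_addr.
      rewrite /=; nia.
  move=> s1 _ s1k.
  by apply: (@halts_assign _ _ _ 5); rewrite /set_var /= ?s1k.
- rewrite /=; nia.
Qed.

End Sets.

(** * Correctness and running time of the whole program *)

Section Main.
Variables (n : nat) (x : 'I_n) (imps : seq (implication 'I_n)).
Variables (ancs : seq 'I_n) (irrs : 'I_n -> seq {set 'I_n}) (N : nat).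
Implicit Types (D : {set 'I_n}) (F : seq {set 'I_n}) (i : implication 'I_n).

Hypothesis le_ground : n <= N.
Hypothesis le_imps : size imps <= N.
Hypothesis le_ancs : size ancs <= N.
Hypothesis le_irrs : \sum_(y <- ancs) size (irrs y) <= N.

Let anc_tree (y : 'I_n) := Node (tree_of_nat y) (tree_of_family (irrs y)).

Let input := tree_of_seq
  [:: tree_of_nat n; tree_of_nat x;
      tree_of_seq [seq tree_of_implication i | i <- imps];
      tree_of_seq [seq anc_tree y | y <- ancs]].

Lemma size_bound_gt0 : 0 < N.
Proof. exact: leq_trans (leq_ltn_trans (leq0n x) (ltn_ord x)) le_ground. Qed.

Lemma size_irrs_le y : y \in ancs -> size (irrs y) <= N.
Proof.
by move=> ya; apply: leq_trans le_irrs; rewrite (big_rem y ya) leq_addr.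
Qed.

Lemma halts_meet_all s D F y : y \in ancs ->
  s v_cand = tree_of_set D -> s v_anc = anc_tree y -> s v_new = tree_of_family F ->
  halts p_meet_all s (130 * N * N)
    (fun s' => s' v_new = tree_of_family (meet_all D F (irrs y))).
Proof.
move=> ya sD sy sF; have N0 := size_bound_gt0; apply: halts_weaken.
  apply: (@halts_foreach _ _ (@tree_of_set n) (fun acc M => (D :&: M) :: acc)
    (@tree_of_family n) v_new _ _ _ _ _ (irrs y) F (60 * n + 45)) => //.
    by rewrite /= sy.
  move=> p M r s1 _ ag1 s1n s1o; apply: halts_weaken.
  - apply: halts_seq; first by apply: (halts_meet (D := D) _ s1o); rewrite ag1.
    move=> s2 ag2 s2m; have s2n : s2 v_new = s1 v_new by rewrite ag2.
    by apply: (@halts_assign _ _ _ 4); rewrite /set_var /= ?s2n ?s1n ?s2m.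
  - by rewrite /=; lia.
by have := size_irrs_le ya; rewrite /=; nia.
Qed.

Lemma halts_meet_ancs s i D F :
  s 0 = input -> s v_imp = tree_of_implication i -> s v_cand = tree_of_set D ->
  s v_new = tree_of_family F ->
  halts p_meet_ancs s (180 * N * N * N)
    (fun s' => s' v_new = tree_of_family (meet_ancs ancs irrs i D F)).
Proof.
move=> s0 si sD sF; have N0 := size_bound_gt0; apply: halts_weaken.
  apply: (@halts_foreach _ _ anc_tree
    (fun acc y => if y \in i.1 then meet_all D acc (irrs y) else acc)
    (@tree_of_family n) v_new _ _ _ _ _ ancs F (160 * N * N)) => //.
    by rewrite /= s0.
  move=> p y r s1 eancs ag1 s1n s1y; apply: halts_weaken.
  - apply: halts_seq.
      apply: (@halts_member n _ _ _ y i.1); first by rewrite /= ag1 // si.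
      by move=> d; rewrite /= /set_var /= s1y.
    move=> s2 ag2 s2d; apply: (halts_if (T := 130 * N * N)); first exact: s2d.
    have s2n : s2 v_new = s1 v_new by rewrite ag2.
    case: (y \in i.1); last first.
      by apply: halts_assign; rewrite /set_var /= ?s2n ?s1n //; nia.
    apply: halts_meet_all.
    + by rewrite eancs mem_cat inE eqxx orbT.
    + by rewrite ag2 // ag1.
    + by rewrite ag2.
    + by rewrite s2n.
  - by rewrite /=; nia.
by rewrite /=; nia.
Qed.

(** [S] bounds all intermediate candidate lists, so that every round of the main loop gets the same
    budget. *)
Lemma halts_extend s i F S : size F <= S -> 0 < S ->
  s 0 = input -> s v_imp = tree_of_implication i -> s v_cands = tree_of_family F ->
  halts p_extend s (250 * S * (N * N * N))
    (fun s' => s' v_cands = tree_of_family (extend x ancs irrs F i)).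
Proof.
move=> leFS S0 s0 si sF; have N0 := size_bound_gt0.
have M0 : N <= N * N * N by nia.
apply: halts_weaken.
- apply: halts_seq.
    apply: (@halts_member n _ _ _ x i.2); first by rewrite /= si.
    by move=> d; rewrite /= /set_var /= s0.
  move=> s1 ag1 s1d.
  apply: (halts_if (T := size F * (180 * N * N * N + 10) + 20)); first exact: s1d.
  have s1c : s1 v_cands = tree_of_family F by rewrite ag1.
  have s10 : s1 0 = input by rewrite ag1.
  have s1i : s1 v_imp = tree_of_implication i by rewrite ag1.
  rewrite /extend; case: (x \in i.2); last first.
    by apply: halts_assign; rewrite /set_var /= ?s1c //; lia.
  apply: halts_weaken.
    apply: halts_assign_seq; apply: halts_seq.
      apply: (@halts_foreach _ _ (@tree_of_set n)
        (fun acc D => meet_ancs ancs irrs i D acc) (@tree_of_family n)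
        v_new _ _ _ _ _ F [::] (180 * N * N * N)) => //.
      by move=> p D r s2 _ ag2 s2n s2D; apply: halts_meet_ancs => //; rewrite ag2.
    move=> s2 _ s2n.
    by apply: (@halts_assign _ _ _ 2); rewrite /set_var /= ?s2n.
  by rewrite /=; lia.
- have : size F * (180 * N * N * N + 10) <= S * (180 * N * N * N + 10).
    by rewrite leq_mul2r leFS orbT.
  have : S * 1 <= S * (N * N * N) by rewrite leq_mul //; lia.
  have : 1 * N <= S * (N * N * N) by rewrite leq_mul.
  by rewrite /=; lia.
Qed.

(** With k the count in the exponent, there are at most N ^ k candidates. Pruning is quadratic in
    them, whence 2k; the extra 4 covers at most N rounds of [p_extend], each with a factor N ^ 3. *)
Lemma halts_main s : s 0 = input ->
  halts p_main s
    (4000 * N ^ (2 * count (fun i => x \in i.2) imps + 4))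
    (fun s' => s' 0 = tree_of_family (prune (prune (candidates x ancs irrs imps)))).
Proof.
move=> s0; have N0 := size_bound_gt0.
set k := count _ _; pose S := N ^ k.
have S0 : 0 < S by rewrite expn_gt0 N0.
have leS p r : imps = p ++ r -> size (candidates x ancs irrs p) <= S.
  by move=> eimps; apply: size_candidates eimps N0 le_irrs.
have leC : size (candidates x ancs irrs imps) <= S.
  by apply: (leS imps [::]); rewrite cats0.
apply: halts_weaken.
- apply: halts_seq; first by apply: (halts_init (x := x)); rewrite s0.
  move=> s1 ag1 s1c; apply: halts_seq.
    apply: (@halts_foreach _ _ (@tree_of_implication n) (extend x ancs irrs)
      (@tree_of_family n) v_cands _ _ _ _ _ imps [:: [set~ x]]
      (250 * S * (N * N * N))) => //.
      by rewrite /= ag1 // s0.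
    move=> p i r s2 eimps ag2 s2c s2i.
    by apply: halts_extend => //; [apply: leS eimps|rewrite ag2 // ag1].
  move=> s2 _ s2c; apply: halts_seq; first exact: halts_prune s2c.
  move=> s3 _ s3c; apply: halts_seq; first exact: halts_prune s3c.
  move=> s4 _ s4c.
  by apply: (@halts_assign _ _ _ 2); rewrite /set_var /= ?s4c.
- rewrite -/(candidates x ancs irrs imps).
  have -> : N ^ (2 * k + 4) = S * S * (N * N * N * N).
    by rewrite expnD mulnC mul2n -addnn expnD mulnC -/S !expnS expn0 muln1 !mulnA.
  have := leq_trans (size_prune _) leC.
  set c1 := size (prune _); set c0 := size _ in leC *.
  move=> le1.
  have N4 : N <= N * N * N * N by rewrite -!mulnA leq_pmulr // !muln_gt0 N0.
  (* Each successor is at most doubled, as [S] and [N] are positive: 1600 = 200 * 2 * 2 * 2. Two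
     passes take 3200 of the 4000. *)
  have pr c : c <= S -> 200 * c.+1 * c.+1 * n.+1 <= 1600 * (S * S * (N * N * N * N)).
    move=> le; apply: (@leq_trans (200 * (2 * S) * (2 * S) * (2 * N))).
      by rewrite !leq_mul //; lia.
    have : S * S * N <= S * S * (N * N * N * N) by rewrite leq_mul.
    by lia.
  have := pr _ leC; have := pr _ le1.
  have : size imps * (250 * S * (N * N * N) + 10) <= 260 * (S * S * (N * N * N * N)).
    apply: (@leq_trans (N * (260 * S * (N * N * N)))).
      rewrite leq_mul //.
      have : 1 <= S * (N * N * N) by rewrite !muln_gt0 S0 N0.
      by lia.
    have : S * (N * N * N * N) <= S * S * (N * N * N * N).
      by rewrite leq_mul2r leq_pmulr ?orbT.
    by lia.
  have : N <= S * S * (N * N * N * N).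
    by apply: leq_trans N4 _; rewrite leq_pmull // muln_gt0 S0.
  rewrite /=; lia.
Qed.

End Main.

(** * The bound in terms of input size and conclusion-degree *)

Lemma count_conclusion_le (T : finType) (Sigma : {set implication T})
    (imps : seq (implication T)) (x : T) :
  lists imps Sigma ->
  count (fun i : implication T => x \in i.2) imps <= conclusion_degree Sigma.
Proof.
move=> /permP->; apply: leq_trans (leq_bigmax x).
by rewrite -sum1_count big_enum_cond /= sum1dep_card.
Qed.

Theorem theorem22 :
  exists (p : command) (c C : nat),
    solves_ACSA_Enum_in_time p
      (fun I : instance => C * input_size I ^ (c * maxn (degree I) 1)).
Proof.
(* The exponent 6 comes from 2k + 4 <= 6 * max(k, 1), and 4000 is the constant of [halts_main]. *)
exists p_main, 6, 4000 => I d [imps [ancs [irrs [limps lancs lirrs ->]]]].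
set N := input_size I; set x := target I.
have sum_irrs : \sum_(y <- ancs) size (irrs y) =
    \sum_(y in anc (base I) x) #|irr (base I) y|.
  rewrite -big_enum /= -(perm_big _ lancs) /=.
  by apply: eq_big_seq => y ya; rewrite (perm_size (lirrs y ya)) -cardE.
have le_ground : ground I <= N by rewrite /N /input_size -addnA leq_addr.
have le_imps : size imps <= N.
  by rewrite (perm_size limps) -cardE /N /input_size -addnA addnCA leq_addr.
have le_ancs : size ancs <= N.
  apply: leq_trans le_ground; rewrite (perm_size lancs) -cardE.
  by apply: leq_trans (max_card _) _; rewrite card_ord.
have le_irrs : \sum_(y <- ancs) size (irrs y) <= N.
  by rewrite sum_irrs leq_addl.
have [|t [s [ex le_t s0]]] := @halts_main _ x _ _ _ _
  le_ground le_imps le_ancs le_irrs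
  (set_var (fun=> Leaf) 0 (tree_of_seq
              [:: tree_of_nat (ground I); tree_of_nat x;
                  tree_of_seq [seq tree_of_implication i | i <- imps];
                  tree_of_seq [seq Node (tree_of_nat y) (tree_of_family (irrs y))
                              | y : 'I_(ground I) <- ancs] ])).
  by [].
exists t; eexists; split; first by exists s; [exact: ex|exact: s0].
  exists (prune (prune (candidates x ancs irrs imps))) => //.
  apply: lists_prune_candidates.
  - exact: base_valid.
  - by move=> y; rewrite (perm_mem lancs) mem_enum.
  - by move=> y ya M; rewrite (perm_mem (lirrs y ya)) mem_enum.
  - by move=> i; rewrite (perm_mem limps) mem_enum.
apply: leq_trans le_t _; rewrite leq_mul2l /=.
have N0 : 0 < N by apply: leq_trans le_ground; apply: leq_ltn_trans (ltn_ord x).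
apply: leq_pexp2l => //.
set k := count _ _; have : k <= degree I by exact: count_conclusion_le.
by move: k (degree I) => k m; lia.
Qed.
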